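(* Let $G$ be a Hausdorff 2-oscillating paratopological group and let $H$ be a normal subgroup of $G$. Endow $G/H$ with the quotient topology. Then: (1) if $H$ is closed in $G^\flat$, then $G/H$ is Hausdorff; (2) if $G$ is regular and the set $H$ is locally compact in $G^\flat$ (i.e. locally compact in the subspace topology inherited from $G^\flat$), then $G/H$ is regular.
   Context: A paratopological group is a group $G$ endowed with a topology $\tau$ making the group operation $G\times G\to G$ continuous (inversion need not be continuous). For a normal subgroup $H$ of $G$, the quotient group $G/H$ with the quotient topology is again a paratopological group. The group reflexion $G^\flat=(G,\tau^\flat)$ of a paratopological group $(G,\tau)$ is the group $G$ endowed with the strongest topology $\tau^\flat\subset\tau$ turning $G$ into a topological group (not necessarily Hausdorff). A paratopological group $G$ with neutral element $e$ is 2-oscillating if for each neighborhood $U\subset G$ of $e$ there is another neighborhood $V\subset G$ of $e$ such that $V^{-1}V\subset UU^{-1}$. (All abelian paratopological groups are 2-oscillating.) A regular space is a Hausdorff space in which every point has a neighborhood base of closed sets. *)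

(* Defs.v *)
From HB Require Import structures.
From mathcomp Require Import all_boot all_order all_algebra.
From mathcomp Require Import all_classical.
From mathcomp Require Import topology.

Set Implicit Arguments.
Unset Strict Implicit.
Unset Printing Implicit Defensive.

Local Open Scope classical_set_scope.
Local Open Scope group_scope.

HB.structure Definition PreTopologicalGroup :=
  {G of Topological G & Group G}.

HB.mixin Record PreTopologicalGroup_isParatopologicalGroup G
    of PreTopologicalGroup G := {
  mulg_continuous : continuous (fun p : G * G => p.1 * p.2)
}.

#[short(type="paratopologicalGroupType")]
HB.structure Definition ParatopologicalGroup :=
  {G of PreTopologicalGroup G & PreTopologicalGroup_isParatopologicalGroup G}.

HB.mixin Record ParatopologicalGroup_isTopologicalGroup G
    of PreTopologicalGroup G := {
  invg_continuous : continuous (fun x : G => x^-1)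
}.

#[short(type="topologicalGroupType")]
HB.structure Definition TopologicalGroup :=
  {G of ParatopologicalGroup G & ParatopologicalGroup_isTopologicalGroup G}.

Definition two_oscillating (G : paratopologicalGroupType) : Prop :=
  forall U : set G, nbhs 1 U -> exists2 V : set G, nbhs 1 V &
    [set x^-1 * y | x in V & y in V] `<=` [set x * y^-1 | x in U & y in U].

(* regular_space alone does not include any separation of points. *)
Definition regular_hausdorff_space (T : topologicalType) : Prop :=
  hausdorff_space T /\ regular_space T.

Section GroupReflexion.
Variable G : paratopologicalGroupType.

Definition coarser_topology (tau : Topological G) : Prop :=
  @open (Topological.Pack tau) `<=` @open G.

Definition group_topology (tau : Topological G) : Prop :=
  let Gt := Topological.Pack tau in
  continuous ((fun p => (p.1 : G) * (p.2 : G)) : Gt * Gt -> Gt) /\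
  continuous ((fun x => (x : G)^-1) : Gt -> Gt).

Definition coarser_group_topology : Type :=
  {tau : Topological G | coarser_topology tau /\ group_topology tau}.

(* The strongest group topology coarser than the given one is the supremum of
   all of them; group_reflexion_coarser, the topologicalGroupType instance and
   group_reflexion_strongest below show that this supremum is one of them. *)
Definition group_reflexion : Type :=
  sup_topology (fun i : coarser_group_topology => sval i).

HB.instance Definition _ := Topological.on group_reflexion.
HB.instance Definition _ := Group.copy group_reflexion G.

Lemma group_reflexion_strongest (tau : Topological G) :
  coarser_topology tau -> group_topology tau ->
  @open (Topological.Pack tau) `<=` @open group_reflexion.
Proof.
move=> tauG gtau.
have /continuousP : continuous (id : group_reflexion -> Topological.Pack tau).
  move=> x.
  have /cvg_sup : nbhs (x : group_reflexion) --> (x : group_reflexion) by [].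
  by move/(_ (exist _ tau (conj tauG gtau))).
by [].
Qed.

Lemma group_reflexion_coarser : @open group_reflexion `<=` @open G.
Proof.
have /continuousP : continuous (id : G -> group_reflexion).
  move=> x; apply/cvg_sup => -[tau [tauG gtau]] /=.
  have /continuousP : forall A, @open (Topological.Pack tau) A -> open (id @^-1` A : set G).
    by move=> A /tauG.
  exact.
by [].
Qed.

Let reflexion_cvg (i : coarser_group_topology) (x : group_reflexion) :
  nbhs x --> (x : Topological.Pack (sval i)).
Proof.
have /cvg_sup : nbhs (x : group_reflexion) --> (x : group_reflexion) by [].
exact.
Qed.

Let reflexion_mulg_continuous :
  continuous (fun p : group_reflexion * group_reflexion => p.1 * p.2).
Proof.
move=> [x y]; apply/cvg_sup => i; have [_ [mulc _]] := svalP i.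
apply: (cvg_trans _ (mulc (x, y))) => A /= [[B C] /= [Bx Cy] BCA].
exists (B, C) => //; split => /=; first exact: (reflexion_cvg Bx).
exact: (reflexion_cvg Cy).
Qed.

Let reflexion_invg_continuous : continuous (fun x : group_reflexion => x^-1).
Proof.
move=> x; apply/cvg_sup => [|i]; first exact: (@fmap_filter _ _ _ _ (nbhs_filter x)).
have [_ [_ invc]] := svalP i.
by move=> A /invc Ax; exact: (reflexion_cvg Ax).
Qed.

HB.instance Definition _ := PreTopologicalGroup_isParatopologicalGroup.Build
  group_reflexion reflexion_mulg_continuous.
HB.instance Definition _ := ParatopologicalGroup_isTopologicalGroup.Build
  group_reflexion reflexion_invg_continuous.

End GroupReflexion.

Record normalSubgroup (G : groupType) := NormalSubgroup {
  normal_carrier :> set G;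
  normal1 : normal_carrier 1;
  normalM : forall x y, normal_carrier x -> normal_carrier y ->
    normal_carrier (x * y);
  normalV : forall x, normal_carrier x -> normal_carrier x^-1;
  normalJ : forall x y, normal_carrier x -> normal_carrier (x ^ y)
}.

Section CosetRelation.
Variables (G : groupType) (H : normalSubgroup G).

Definition coset_rel : rel G := fun x y => `[< normal_carrier H (x^-1 * y) >].

Let coset_rel_equiv : equiv_class_of coset_rel.
Proof.
split.
- by move=> x; apply/asboolP; rewrite mulVg; exact: normal1.
- move=> x y; apply/asboolP/asboolP => /normalV; by rewrite invgM invgK.
- move=> y x z /asboolP Hxy /asboolP Hyz; apply/asboolP.
  by have := normalM Hxy Hyz; rewrite mulgA mulgK.
Qed.

Canonical coset_equiv : equiv_rel G := EquivRelPack coset_rel_equiv.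

End CosetRelation.

Section QuotientGroup.
Variables (G : paratopologicalGroupType) (H : normalSubgroup G).
Local Open Scope quotient_scope.

Definition quotient_group : Type :=
  quotient_topology {eq_quot (coset_equiv H)}.

HB.instance Definition _ := Topological.on quotient_group.
HB.instance Definition _ := Quotient.on quotient_group.

Local Notation Q := quotient_group.

Lemma quotient_group_eqP (x y : G) :
  reflect (normal_carrier H (x^-1 * y)) (\pi_Q x == \pi_Q y).
Proof.
have -> : (\pi_Q x == \pi_Q y) = coset_rel H x y.
  by apply/eqP/idP => [/eqmodP|/eqmodP].
exact: asboolP.
Qed.

Let H_repr (x : G) : normal_carrier H ((repr (\pi_Q x))^-1 * x).
Proof. by apply/quotient_group_eqP; rewrite reprK. Qed.

Definition quotient_one : Q := \pi_Q 1.
Definition quotient_mul (a b : Q) : Q := \pi_Q (repr a * repr b).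
Definition quotient_inv (a : Q) : Q := \pi_Q (repr a)^-1.

Let piM x y : quotient_mul (\pi_Q x) (\pi_Q y) = \pi_Q (x * y).
Proof.
apply/eqP/quotient_group_eqP; rewrite invgM.
set x' := repr (\pi_Q x); set y' := repr (\pi_Q y).
have -> : y'^-1 * x'^-1 * (x * y) = (x'^-1 * x) ^ y' * (y'^-1 * y).
  by rewrite /conjg !mulgA mulgK.
by apply: normalM; [apply: normalJ|]; exact: H_repr.
Qed.

Let piV x : quotient_inv (\pi_Q x) = \pi_Q x^-1.
Proof.
apply/eqP/quotient_group_eqP; rewrite invgK; set x' := repr (\pi_Q x).
have -> : x' * x^-1 = ((x'^-1 * x) ^ x'^-1)^-1.
  by rewrite /conjg invgK !mulgA mulgV mul1g invgM invgK.
by apply/normalV/normalJ; exact: H_repr.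
Qed.

Let pi_surj (a : Q) : exists x, a = \pi_Q x.
Proof. by exists (repr a); rewrite reprK. Qed.

Let quotient_mulA : associative quotient_mul.
Proof.
move=> a b c; have [x ->] := pi_surj a; have [y ->] := pi_surj b.
by have [z ->] := pi_surj c; rewrite !piM mulgA.
Qed.

Let quotient_mul1g : left_id quotient_one quotient_mul.
Proof. by move=> a; have [x ->] := pi_surj a; rewrite piM mul1g. Qed.

Let quotient_mulg1 : right_id quotient_one quotient_mul.
Proof. by move=> a; have [x ->] := pi_surj a; rewrite piM mulg1. Qed.

Let quotient_mulVg : left_inverse quotient_one quotient_inv quotient_mul.
Proof. by move=> a; have [x ->] := pi_surj a; rewrite piV piM mulVg. Qed.

Let quotient_mulgV : right_inverse quotient_one quotient_inv quotient_mul.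
Proof. by move=> a; have [x ->] := pi_surj a; rewrite piV piM mulgV. Qed.

HB.instance Definition _ := isGroup.Build Q quotient_mulA quotient_mul1g
  quotient_mulg1 quotient_mulVg quotient_mulgV.

Lemma quotient_piM (x y : G) : \pi_Q x * \pi_Q y = \pi_Q (x * y) :> Q.
Proof. exact: piM. Qed.

Let open_pi (U : set G) : open U -> open (\pi_Q @` U).
Proof.
move=> oU; rewrite /open /= /quotient_open.
have -> : \pi_Q @^-1` (\pi_Q @` U) = \bigcup_(h in normal_carrier H) ((fun x => x * h) @^-1` U).
  apply/seteqP; split => x /=.
    move=> [u Uu /esym/eqP/quotient_group_eqP Hxu]; exists (x^-1 * u) => //=.
    by rewrite mulgA mulgV mul1g.
  move=> [h Hh /= Uxh]; exists (x * h) => //; apply/esym/eqP/quotient_group_eqP.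
  by rewrite mulgA mulVg mul1g.
apply: bigcup_open => h _.
have /continuousP : continuous (fun x : G => x * h).
  move=> x.
  apply: (@continuous_comp _ _ _ (fun x : G => (x, h)) (fun p : G * G => p.1 * p.2)).
    by apply: cvg_pair => //=; exact: cvg_cst.
  exact: mulg_continuous.
exact.
Qed.

Let quotient_mulg_continuous : continuous (fun p : Q * Q => p.1 * p.2).
Proof.
move=> [a b] W Wab.
have : nbhs (repr a * repr b) (\pi_Q @^-1` W).
  by apply: pi_continuous; rewrite -quotient_piM !reprK.
move=> /(mulg_continuous (repr a, repr b)) [[A B] /= [+ +] ABW].
rewrite (nbhsE (repr a)) (nbhsE (repr b)) => -[A' [oA' A'a] A'A] [B' [oB' B'b] B'B].
exists (\pi_Q @` A', \pi_Q @` B') => /=.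
  split; apply: open_nbhs_nbhs; split; try exact: open_pi.
    by exists (repr a) => //; rewrite reprK.
  by exists (repr b) => //; rewrite reprK.
move=> [_ _] /= [[x A'x <-] [y B'y <-]]; rewrite quotient_piM.
by apply: (ABW (x, y)); split; [exact: A'A|exact: B'B].
Qed.

HB.instance Definition _ := PreTopologicalGroup_isParatopologicalGroup.Build Q
  quotient_mulg_continuous.

End QuotientGroup.

(* Main.v *)
Require Import Defs.
From HB Require Import structures.
From mathcomp Require Import all_boot all_order all_algebra.
From mathcomp Require Import all_classical.
From mathcomp Require Import topology.

(* In a 2-oscillating group the sets U U^-1 form a neighbourhood base at 1 of
   the group reflexion. Hence two cosets xH and yH whose images in G/H cannot
   be separated satisfy x^-1 y \in U U^-1 H for all U, that is, x^-1 y lies in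
   the closure of H in the reflexion. If H is locally compact in the reflexion,
   it is closed there, and regularity of G/H amounts to finding W with
   closure (W H) inside a given U H. Compactness gives closure (W H) inside K H
   where K is the intersection over V of the sets W V V^-1, and K is contained
   in closure (W W), hence in U for W small by regularity of G. *)

Set Implicit Arguments.
Unset Strict Implicit.
Unset Printing Implicit Defensive.

Local Open Scope classical_set_scope.
Local Open Scope group_scope.

(** * Translations, conjugations and products of neighbourhoods *)

Section ParatopologicalGroupNbhs.
Variable T : paratopologicalGroupType.

Lemma nbhs_mulg (x y : T) (A : set T) : nbhs (x * y) A ->
  exists2 B : set T * set T, nbhs x B.1 /\ nbhs y B.2 &
    forall u v, B.1 u -> B.2 v -> A (u * v).
Proof.
move=> /(mulg_continuous (x, y)) [[U V] /= UV UVA].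
by exists (U, V) => // u v Uu Vv; exact: (UVA (u, v)).
Qed.

Lemma nbhs_lmulg (x y : T) (A : set T) :
  nbhs (x * y) A -> nbhs y [set u | A (x * u)].
Proof.
move=> /nbhs_mulg[[U V] /= [xU yV] UVA].
by apply: filterS yV => v Vv; apply: UVA => //; exact: nbhs_singleton.
Qed.

Lemma nbhs_rmulg (x y : T) (A : set T) :
  nbhs (x * y) A -> nbhs x [set u | A (u * y)].
Proof.
move=> /nbhs_mulg[[U V] /= [xU yV] UVA].
by apply: filterS xU => u Uu; apply: UVA => //; exact: nbhs_singleton.
Qed.

Lemma nbhs1_lmulVg (x : T) (A : set T) :
  nbhs 1 A -> nbhs x [set y | A (x^-1 * y)].
Proof. by move=> A1; apply: nbhs_lmulg; rewrite mulVg. Qed.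

Lemma nbhs1_conjg (y : T) (A : set T) : nbhs 1 A -> nbhs 1 [set u | A (u ^ y)].
Proof.
move=> A1; apply: (@nbhs_rmulg _ y [set u | A (y^-1 * u)]).
by apply: nbhs_lmulg; rewrite mul1g mulVg.
Qed.

Lemma nbhs1_mulg (A : set T) : nbhs 1 A ->
  exists2 U : set T, nbhs 1 U & forall u v, U u -> U v -> A (u * v).
Proof.
rewrite -{1}(mulg1 1) => /nbhs_mulg[[U V] /= [U1 V1] UVA].
by exists (U `&` V) => [|u v [Uu _] [_ Vv]]; [exact: filterI|exact: UVA].
Qed.

End ParatopologicalGroupNbhs.

(** * Locally compact subgroups of topological groups *)

Section TopologicalGroupNbhs.
Variable T : topologicalGroupType.

Lemma nbhs1_divg (A : set T) : nbhs 1 A ->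
  exists2 U : set T, nbhs 1 U & forall u v, U u -> U v -> A (u * v^-1).
Proof.
move=> /nbhs1_mulg[U U1 UA]; exists (U `&` [set x | U x^-1]).
  by apply: filterI => //; apply: invg_continuous; rewrite invg1.
by move=> u v [Uu _] [_ Uv]; exact: UA.
Qed.

Lemma nbhs1_divlg (A : set T) : nbhs 1 A ->
  exists2 U : set T, nbhs 1 U & forall u v, U u -> U v -> A (u^-1 * v).
Proof.
move=> /nbhs1_mulg[U U1 UA]; exists (U `&` [set x | U x^-1]).
  by apply: filterI => //; apply: invg_continuous; rewrite invg1.
by move=> u v [_ Uu] [Uv _]; exact: UA.
Qed.

(** Take [O] whose trace on [H] lies in a compact neighbourhood of 1 in [H]. For [a] in [E], the
    translate of [E] by [a^-1] falls into that compact set, so the translated filter clusters there.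
    One [O] serves all filters. *)
Lemma locally_compact_subgroup_cluster (H : set T) :
  H 1 -> (forall x y, H x -> H y -> H (x^-1 * y)) ->
  locally_compact [set: set_type H] ->
  exists2 O : set T, nbhs 1 O &
    forall (F : set_system T) (E : set T), ProperFilter F -> F E -> E `<=` H ->
      (forall a b, E a -> E b -> O (a^-1 * b)) ->
      exists2 k, H k & cluster F k.
Proof.
move=> H1 HV lcH.
have [C /= + [cC _]] := lcH (exist _ 1 (mem_set H1)) I.
rewrite withinET => -[_ [/= [O oO <-] O1 OC]].
have cK : compact [set set_val x | x in C].
  apply: continuous_compact cC.
  by apply: continuous_subspaceT; exact: initial_continuous.
exists O => [|F E PF FE EH EO]; first exact: open_nbhs_nbhs.
have [a Ea] := filter_ex FE.
have [|k [[c _ <-] kF]] := cK ((fun b => a^-1 * b) @ F) _.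
  apply: (@filterS _ F _ E) FE => b Eb /=.
  have Hab : H (a^-1 * b) by apply: HV; exact: EH.
  exists (exist (fun x => x \in H) _ (mem_set Hab)) => //.
  by apply: OC; exact: EO.
have HVa : H a^-1 by rewrite -[a^-1]mulg1; apply: HV => //; exact: EH.
exists (a * set_val c : T).
  by rewrite -(invgK a); apply: HV => //; apply: set_mem; exact: (valP c).
move=> A N FA kN.
have [|y []] := kF [set y | A (a * y)] [set y | N (a * y)] _ (nbhs_lmulg kN).
  by apply: (@filterS _ F _ A) FA => b /=; rewrite mulgA mulgV mul1g.
by exists (a * y).
Qed.

(** The neighbourhoods of [x] traced on [H] contain arbitrarily small sets, hence cluster at some
    [k] in [H]; the Hausdorff property forces [k = x]. *)
Lemma locally_compact_subgroup_closed (H : set T) :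
  hausdorff_space T -> H 1 -> (forall x y, H x -> H y -> H (x^-1 * y)) ->
  locally_compact [set: set_type H] -> closed H.
Proof.
move=> hT H1 HV lcH x clHx.
have [O O1 clO] := locally_compact_subgroup_cluster H1 HV lcH.
have [P P1 PO] := nbhs1_divlg O1.
have PF : ProperFilter (within H (nbhs x)) by exact: within_nbhs_proper.
have [|||k Hk kx] := clO _ ([set y | P (x^-1 * y)] `&` H) PF.
- apply: filterI; last exact: withinT.
  by have := nbhs1_lmulVg x P1; exact: cvg_within.
- by move=> y [].
- move=> a b [Pa _] [Pb _]; have := PO _ _ Pa Pb.
  by rewrite invgM invgK mulgA mulgK.
by rewrite (hT x k) //; apply: cvg_cluster kx; exact: cvg_within.
Qed.

End TopologicalGroupNbhs.

(** * The group topology with base [U U^-1] at 1 *)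

(** Oscillation rewrites the middle factor [b^-1 * c] as [x * y^-1], which regroups the product as
    [(a * x) * (d * y)^-1]. *)
Lemma two_oscillating_mul (G : paratopologicalGroupType) (U : set G) :
  two_oscillating G -> nbhs 1 U -> exists2 V : set G, nbhs 1 V &
    forall a b c d, V a -> V b -> V c -> V d ->
      [set x * y^-1 | x in U & y in U] (a * b^-1 * (c * d^-1)).
Proof.
move=> osc /nbhs1_mulg[U' U'1 U'U]; have [V V1 VU'] := osc _ U'1.
exists (V `&` U'); first exact: filterI.
move=> a b c d [_ Ua] [Vb _] [Vc _] [_ Ud].
have [x Ux [y Uy xy]] : [set x * y^-1 | x in U' & y in U'] (b^-1 * c).
  by apply: VU'; exists b => //; exists c.
exists (a * x); first exact: U'U.
exists (d * y); first exact: U'U.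
by rewrite invgM !mulgA -[a * x * _]mulgA xy !mulgA.
Qed.

(** The alias keeps [osc] as a parameter, because the topology axioms put on it depend on that
    proof. *)
Definition oscillator_group (G : paratopologicalGroupType)
  (osc : two_oscillating G) : Type := G.

Section OscillatorTopology.
Variables (G : paratopologicalGroupType) (osc : two_oscillating G).
Local Notation T := (oscillator_group osc).

HB.instance Definition _ := Group.copy T G.

Definition oscillator_nbhs (x : T) : set_system T := [set A |
  exists2 U : set G, nbhs 1 U &
    forall u v, U u -> U v -> A ((x : G) * (u * v^-1))].

HB.instance Definition _ := hasNbhs.Build T oscillator_nbhs.

Let oscillator_filter (x : T) : ProperFilter (nbhs x).
Proof.
split.
  by case=> U U1 /(_ _ _ (nbhs_singleton U1) (nbhs_singleton U1)).
split=> [|A B [U U1 UA] [V V1 VB]|A B AB [U U1 UA]].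
- by exists setT => //; exact: filterT.
- exists (U `&` V); first exact: filterI.
  by move=> u v [Uu Vu] [Uv Vv]; split; [exact: UA|exact: VB].
- by exists U => // u v Uu Uv; apply: AB; exact: UA.
Qed.

Let oscillator_singleton (x : T) (A : set T) : nbhs x A -> A x.
Proof.
case=> U U1 /(_ _ _ (nbhs_singleton U1) (nbhs_singleton U1)).
by rewrite mulgV mulg1.
Qed.

Let oscillator_nbhs_nbhs (x : T) (A : set T) : nbhs x A -> nbhs x (nbhs^~ A).
Proof.
case=> U U1 UA; have [V V1 VU] := two_oscillating_mul osc U1.
exists V => // a b Va Vb; exists V => // c d Vc Vd.
have [p Up [q Uq pq]] := VU _ _ _ _ Va Vb Vc Vd.
by rewrite -mulgA -pq; exact: UA.
Qed.

HB.instance Definition _ := Nbhs_isNbhsTopological.Build T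
  oscillator_filter oscillator_singleton oscillator_nbhs_nbhs.

Lemma oscillator_coarser : coarser_topology (Topological.class T).
Proof.
move=> A /=; rewrite /coarser_topology openE => oA.
rewrite openE => x /oA [U U1 UA].
rewrite /interior; have := nbhs1_lmulVg (x : G) U1.
apply: filterS => y /= Uy; have := UA _ _ Uy (nbhs_singleton U1).
by rewrite invg1 mulg1 mulgA mulgV mul1g.
Qed.

Lemma oscillator_group_topology : group_topology (Topological.class T).
Proof.
split.
  move=> [x y] A /= [U U1 UA]; have [V V1 VU] := two_oscillating_mul osc U1.
  (* Moving [y] to the left across [a * b^-1] conjugates both factors by [y], so smallness is
     required of the conjugates. *)
  exists ([set z | exists a b, [/\ V (a ^ y), V (b ^ y) & z = x * (a * b^-1)]],
          [set z | exists c d, [/\ V c, V d & z = y * (c * d^-1)]]) => /=.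
    split.
      exists [set u | V (u ^ y)]; first exact: nbhs1_conjg.
      by move=> a b Va Vb; exists a, b.
    by exists V => // c d Vc Vd; exists c, d.
  move=> [_ _] /= [[a [b [Va Vb ->]]] [c [d [Vc Vd ->]]]].
  have [p Up [q Uq pq]] := VU _ _ _ _ Va Vb Vc Vd.
  have -> : x * (a * b^-1) * (y * (c * d^-1)) = x * y * (p * q^-1).
    by rewrite pq /conjg !invgM !invgK !mulgA !mulgK.
  exact: UA.
move=> x A /= [U U1 UA].
(* Inverting [x * (a * b^-1)] swaps [a] and [b] and conjugates them by [x^-1]. *)
exists [set u | U (u ^ x^-1)]; first exact: nbhs1_conjg.
move=> a b Ua Ub /=; have := UA _ _ Ub Ua; rewrite /conjg !invgM !invgK.
by rewrite !mulgA mulVg mul1g !mulgVK.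
Qed.

End OscillatorTopology.

(** * Neighbourhoods and separation in the reflexion *)

Section Reflexion.
Variable G : paratopologicalGroupType.
Local Notation Gb := (group_reflexion G).

Lemma reflexion_nbhs_coarser (x : G) (A : set G) :
  nbhs (x : Gb) A -> nbhs x A.
Proof.
rewrite !nbhsE => -[B [oB Bx] BA]; exists B => //.
by split => //; exact: group_reflexion_coarser.
Qed.

(** The oscillator topology is a group topology coarser than that of [G], so the reflexion refines
    it. *)
Lemma reflexion_nbhs1 (U : set G) : two_oscillating G -> nbhs 1 U ->
  nbhs (1 : Gb) [set x * y^-1 | x in U & y in U].
Proof.
move=> osc U1.
have : nbhs (1 : oscillator_group osc) [set x * y^-1 | x in U & y in U].
  by exists U => // u v Uu Uv; rewrite mul1g; exists u => //; exists v.
rewrite !nbhsE => -[B [oB B1] BU]; exists B => //; split => //.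
exact: (group_reflexion_strongest (@oscillator_coarser _ osc)
  (@oscillator_group_topology _ osc)).
Qed.

Lemma reflexion_hausdorff :
  two_oscillating G -> hausdorff_space G -> hausdorff_space Gb.
Proof.
move=> osc hG x y xy; apply: hG => A B Ax By.
pose U := [set u | A (x * u)] `&` [set u | B (y * u)].
have U1 : nbhs (1 : G) U.
  by apply: filterI; apply: nbhs_lmulg; rewrite mulg1.
(* A point [z] in both [x P] and [y P] yields [x^-1 * y = u * v^-1] with [u], [v] in [U]; then
   [x * u = y * v] lies in [A] and in [B]. *)
have [P P1 PU] := nbhs1_divg (reflexion_nbhs1 osc U1).
have [z [/= Pxz Pyz]] := xy _ _ (nbhs1_lmulVg x P1) (nbhs1_lmulVg y P1).
have [u [Au _] [v [_ Bv] uv]] := PU _ _ Pxz Pyz.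
exists (x * u); split => //; suff -> : x * u = y * v by [].
move: uv; rewrite invgM invgK mulgA mulgK => uv.
by rewrite -(mulgVK v u) uv !mulgA mulgV mul1g.
Qed.

End Reflexion.

(** * Separation in the quotient *)

Section Quotient.
Variables (G : paratopologicalGroupType) (H : normalSubgroup G).
Local Open Scope quotient_scope.
Local Notation Q := (quotient_group H).
Local Notation Gb := (group_reflexion G).

Lemma quotient_group_pi_nbhs (x : G) (A : set G) :
  nbhs x A -> nbhs (\pi_Q x) [set \pi_Q y | y in A].
Proof.
rewrite nbhsE => -[U [oU Ux] UA].
apply: (@filterS _ _ _ [set \pi_Q y | y in U]); first exact: image_subset.
apply: open_nbhs_nbhs; split; last by exists x.
rewrite /open /= /quotient_open openE => y [u Uu].
move=> /eqP/quotient_group_eqP Huy.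
have : nbhs y [set z | U (z * (y^-1 * u))].
  apply: nbhs_rmulg; rewrite mulgA mulgV mul1g.
  exact: open_nbhs_nbhs.
apply: filterS => z Uz; exists (z * (y^-1 * u)) => //.
apply/eqP/quotient_group_eqP; rewrite !invgM invgK mulgVK.
exact: Huy.
Qed.

Lemma quotient_hausdorff :
  closed (H : set Gb) -> hausdorff_space Q.
Proof.
move=> cH p q; rewrite -(reprK p) -(reprK q).
set x := repr p; set y := repr q => xy.
apply/eqP/quotient_group_eqP; apply: cH => N Nz.
have [|P P1 PN] := @nbhs1_divg Gb [set u | N (u * (x^-1 * y))].
  by apply: (@nbhs_rmulg Gb); rewrite mul1g.
have {}P1 := reflexion_nbhs_coarser P1.
have [_ [[a /= Pa <-] [b /= Pb]]] := xy _ _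
  (quotient_group_pi_nbhs (nbhs1_lmulVg x P1))
  (quotient_group_pi_nbhs (nbhs1_lmulVg y P1)).
move=> /eqP/quotient_group_eqP Hba.
(* The product collapses to [y^-1 * (b * a^-1) * y], which is in [H] by normality. *)
exists (y^-1 * b * (x^-1 * a)^-1 * (x^-1 * y)); split; last exact: PN.
rewrite (_ : _ * _ = ((b^-1 * a) ^ (b^-1 * y))^-1); last first.
  by rewrite /conjg !invgM !invgK !mulgA !mulgK.
by apply/normalV/normalJ.
Qed.

(* A point [x] of the closure gives, as [V] shrinks, elements [h] of [H] with
   [x V] meeting [h W]. They differ by elements of [W V^-1 V W^-1], which is
   small in the reflexion, so local compactness provides a cluster point [k],
   and [k^-1 x] then lies in [W V V^-1] for every [V]. *)
Lemma closure_saturation_subset (U : set G) :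
  two_oscillating G -> regular_space G ->
  locally_compact [set: @set_type Gb H] -> nbhs 1 U ->
  exists2 W : set G, nbhs 1 W &
    closure [set w * h | w in W & h in (H : set G)] `<=`
      [set u * h | u in U & h in (H : set G)].
Proof.
move=> osc rG lcH U1; have [U0 U01 clU0] := rG 1 _ U1.
have [W1 W11 W1U0] := nbhs1_mulg U01.
have [||O O1 clO] := @locally_compact_subgroup_cluster Gb H _ _ lcH.
- exact: normal1.
- by move=> x y Hx Hy; apply: normalM => //; exact: normalV.
have [P1 P11 P1O] := nbhs1_divg O1; have [P P_1 PP1] := nbhs1_divg P11.
pose W := W1 `&` P.
have W_1 : nbhs (1 : G) W.
  by apply: filterI => //; exact: reflexion_nbhs_coarser.
exists W => // x clx.
pose E V := [set h : Gb | (H : set G) h /\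
  exists v w : G, [/\ V v, W w & x * v = h * w]].
pose F := filter_from (nbhs (1 : G)) E.
have PF : ProperFilter F.
  apply: filter_from_proper => [|V V1].
    apply: filter_from_filter; first by exists setT; exact: filterT.
    move=> A B A1 B1; exists (A `&` B); first exact: filterI.
    by move=> h [Hh [v [w [[Av Bv] Ww e]]]]; split; split=> //; exists v, w.
  have [y [[w Ww [h Hh whE]] /= Vy]] := clx _ (nbhs1_lmulVg x V1).
  (* Normality moves [h] to the left of [w]: [w * h = (h ^ w^-1) * w]. *)
  exists (h ^ w^-1); split; first exact: normalJ.
  exists (x^-1 * y), w; split=> //.
  by rewrite -whE /conjg invgK !mulgA mulgV mul1g mulgVK.
have [|||k Hk kF] := clO F (E W) PF.
- by exists W.
- by move=> h [].
- move=> a b [_ [v [w [[_ Pv] [_ Pw] vw]]]] [_ [v' [w' [[_ Pv'] [_ Pw'] vw']]]].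
  have := P1O _ _ (PP1 _ _ Pw Pv) (PP1 _ _ Pw' Pv').
  congr (O _); rewrite -(mulgK w' b) -vw' -(mulgK w a) -vw.
  by rewrite !invgM !invgK !mulgA mulgVK.
have Uy : U (k^-1 * x).
  apply: clU0 => A Ay.
  pose V := W1 `&` [set v | A (k^-1 * x * v)].
  have V1 : nbhs (1 : G) V.
    by apply: filterI => //; apply: nbhs_lmulg; rewrite mulg1.
  (* For [h] close to [k], both [v] and [(h * k^-1) ^ x] lie in [S], so
     [v^-1 * (h * k^-1) ^ x = p * q^-1] with [p], [q] in [V]. Together with [x * v = h * w] this
     gives [k^-1 * x * q = w * p], a point of both [A] and [U0]. *)
  have [S S1 SV] := nbhs1_divlg (reflexion_nbhs1 osc V1).
  have [||h [[Hh [v [w [Sv [W1w _] vw]]]] /= Sh]] :=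
    kF (E S) [set z | S ((z * k^-1) ^ x)].
  - by exists S => //; exact: reflexion_nbhs_coarser.
  - apply: (@nbhs_rmulg Gb _ _ [set z | S (z ^ x)]); rewrite mulgV.
    exact: (@nbhs1_conjg Gb).
  have [p [W1p _] [q [_ Aq] pq]] := SV _ _ Sv Sh.
  exists (k^-1 * x * q); split=> //.
  suff -> : k^-1 * x * q = w * p by exact: W1U0.
  rewrite -(mulgVK q p) pq /conjg.
  have -> : w = h^-1 * (x * v) by rewrite vw mulgA mulVg mul1g.
  by rewrite !mulgA !mulgK mulVg mul1g.
exists (k^-1 * x) => //; exists (k ^ (k^-1 * x)); first exact: normalJ.
by rewrite /conjg !mulgA mulgV mul1g mulgV mul1g.
Qed.

Lemma quotient_regular : two_oscillating G -> regular_space G ->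
  locally_compact [set: @set_type Gb H] -> regular_space Q.
Proof.
move=> osc rG lcH a B aB.
have U1 : nbhs (1 : G) [set u | B (a * \pi_Q u)].
  apply: (@pi_continuous _ _ 1 [set c | B (a * c)]).
  by apply: (@nbhs_lmulg Q); rewrite mulg1.
have [W W1 clW] := closure_saturation_subset osc rG lcH U1.
exists [set c | [set \pi_Q w | w in W] (a^-1 * c)].
  by apply: (@nbhs1_lmulVg Q); exact: quotient_group_pi_nbhs.
move=> b clb; rewrite -[b]mul1g -(mulgV a) -mulgA -[a^-1 * b]reprK.
set y := repr _.
(* As the projection sends neighbourhoods to neighbourhoods, closure in the quotient pulls back to
   closure of the saturation [W H] in [G]. *)
have /clW[u Bu [h Hh <-]] : closure [set w * h | w in W & h in (H : set G)] y.
  move=> N yN.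
  have [|c [[w Ww wc] [n Nn nc]]] :=
    clb [set c | [set \pi_Q n | n in N] (a^-1 * c)].
    apply: (@nbhs_lmulg Q); rewrite -[a^-1 * b]reprK.
    exact: quotient_group_pi_nbhs.
  exists n; split=> //; exists w => //; exists (w^-1 * n).
    by apply/quotient_group_eqP; rewrite wc nc.
  by rewrite mulgA mulgV mul1g.
suff -> : \pi_Q (u * h) = \pi_Q u by [].
apply/esym/eqP/quotient_group_eqP.
by rewrite mulgA mulVg mul1g.
Qed.

End Quotient.

Theorem corollary2 (G : paratopologicalGroupType) (H : normalSubgroup G) :
  hausdorff_space G -> two_oscillating G ->
  (closed (H : set (group_reflexion G)) ->
     hausdorff_space (quotient_group H)) /\
  (regular_hausdorff_space G ->
   locally_compact [set: @set_type (group_reflexion G) H] ->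
     regular_hausdorff_space (quotient_group H)).
Proof.
move=> hG osc; split; first exact: quotient_hausdorff.
move=> [_ rG] lcH; split; last exact: quotient_regular.
apply: quotient_hausdorff; apply: locally_compact_subgroup_closed lcH.
- exact: reflexion_hausdorff.
- exact: normal1.
- by move=> x y Hx Hy; apply: normalM => //; exact: normalV.
Qed.
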